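(* Let $\beta\in\mathrm{Br}_n^+$ be a positive braid word. Let $\{1,\dots,n\}=I_1\sqcup\dots\sqcup I_k$ be a set partition in which each $I_j$ is a union of orbits of $\pi(\beta)$ (equivalently, a set partition of the set $C$ of connected components of the braid closure $\overline\beta$), and let $T_{I_1,\dots,I_k}=\{(t_1,\dots,t_n)\in(\mathbb{C}^\times)^n: t_i=t_{i'}\text{ whenever } i,i' \text{ belong to the same } I_j\}$. For $j=1,\dots,k$ let $\beta_j$ be the braid obtained from $\beta$ by considering only the strands indexed by $I_j$. Then the set of elements of $\mathrm{BS}(\beta)$ that are stabilized by $T_{I_1,\dots,I_k}$ is isomorphic to $\mathrm{BS}(\beta_1)\times\cdots\times\mathrm{BS}(\beta_k)$. In particular, the intersection of the sets of points stabilized by two such subtori of $(\mathbb{C}^\times)^n$ is isomorphic to the product of double Bott–Samelson varieties associated with the coarsest common refinement of the two corresponding partitions of $C$.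
   Context: $\mathrm{Br}_n^+$ is the positive braid monoid on $n$ strands with generators $\sigma_1,\dots,\sigma_{n-1}$; $\pi(\sigma_{i_1}\cdots\sigma_{i_\ell})=s_{i_1}\cdots s_{i_\ell}\in S_n$ with $s_i=(i\ \,i+1)$. For $1\le i\le n-1$, $B_i(z)$ is the $n\times n$ identity matrix except for the block $\begin{pmatrix} z&-1\\1&0\end{pmatrix}$ in rows and columns $i,i+1$. For a word $\beta=\sigma_{i_1}\cdots\sigma_{i_\ell}$, $B_\beta(z_1,\dots,z_\ell)=B_{i_1}(z_1)\cdots B_{i_\ell}(z_\ell)$, and the double Bott–Samelson variety is $\mathrm{BS}(\beta)=\{(z_1,\dots,z_\ell)\in\mathbb{C}^\ell: \Delta_{[1,i],[1,i]}B_\beta(z)\ne0,\ i=1,\dots,n-1\}$, where $\Delta_{[1,i],[1,i]}$ is the leading principal $i\times i$ minor. (For one strand, or an empty word, it is a point.) Strands: draw $\beta$ from left to right on levels $1,\dots,n$, the letter $\sigma_i$ being a crossing of the strands at levels $i$ and $i+1$; the $p$-th strand is the one at level $p$ at the left end. The torus $(\mathbb{C}^\times)^n$ acts on $\mathrm{BS}(\beta)$ by multiplying $z_k$ by $t_p/t_q$, where $p$ (resp. $q$) is the strand at level $i_k$ (resp. $i_k+1$) just before the $k$-th crossing. The braid $\beta_j$ is obtained from the diagram of $\beta$ by deleting all strands not indexed by $I_j$; it is a positive braid on $|I_j|$ strands. *)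

(* Defs.v *)
From HB Require Import structures.
From mathcomp Require Import all_boot all_order all_algebra all_fingroup.
From mathcomp Require Import reals.
From mathcomp Require Import complex.
From mathcomp Require Import mpoly.

Set Implicit Arguments.
Unset Strict Implicit.
Unset Printing Implicit Defensive.

Import GRing.Theory.
Local Open Scope ring_scope.

(* Strands, levels and generators are numbered from 0.  A braid word on n
   strands is a [seq 'I_n.-1], the letter i being a crossing of the levels i
   and i.+1 of ['I_n]. *)

Section BraidWords.
Variable n : nat.
Implicit Types (w : seq 'I_n.-1) (A B : {set 'I_n}) (P Q S : {set {set 'I_n}}).

Definition lo (i : 'I_n.-1) : 'I_n := widen_ord (leq_pred n) i.

Lemma hi_subproof (i : 'I_n.-1) : (i.+1 < n)%N.
Proof. by rewrite -ltn_predRL. Qed.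

Definition hi (i : 'I_n.-1) : 'I_n := Ordinal (hi_subproof i).

(* MathComp multiplies permutations from left to right, so [braid_perm w p] is
   the level at the right end of the strand p.  With the opposite convention
   one gets the inverse permutation, which has the same orbits. *)
Definition braid_perm w : 'S_n := (\prod_(i <- w) tperm (lo i) (hi i))%g.

Definition letter w (k : 'I_(size w)) : 'I_n.-1 := tnth (in_tuple w) k.

(* [level w k r] is the level of the strand r just before the crossing k. *)
Definition level w (k : 'I_(size w)) : 'S_n := braid_perm (take k w).

Definition strand_lo w (k : 'I_(size w)) : 'I_n :=
  (level k)^-1%g (lo (letter k)).
Definition strand_hi w (k : 'I_(size w)) : 'I_n :=
  (level k)^-1%g (hi (letter k)).

(* A crossing survives in the braid of the strands in A when both its strands
   are in A; it is then at the level given by the number of strands of A which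
   are below it. *)
Definition sub_letters A w : seq nat :=
  [seq #|[set r in A | (level k r < letter k)%N]|
     | k <- enum 'I_(size w) & (strand_lo k \in A) && (strand_hi k \in A)].

(* [insub] never fails here, see [val_subbraid]. *)
Definition subbraid A w : seq 'I_#|A|.-1 := pmap insub (sub_letters A w).

Lemma val_subbraid A w : map val (subbraid A w) = sub_letters A w.
Proof.
rewrite /subbraid pmap_filter; last exact: insubK.
apply/all_filterP/allP => m /mapP[k]; rewrite mem_filter => /andP[/andP[pA qA] _] ->.
rewrite /= isSome_insub ltn_predRL.
set C := [set r in A | _].
have lp : level k (strand_lo k) = lo (letter k) by rewrite permKV.
have lq : level k (strand_hi k) = hi (letter k) by rewrite permKV.
have pC : strand_lo k \notin C by rewrite inE lp ltnn andbF.
have qC : strand_hi k \notin strand_lo k |: C.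
  rewrite !inE lq /= ltnNge leqnSn andbF orbF.
  apply/eqP => pq; move: lp; rewrite -pq lq => /(congr1 val) /= /eqP.
  by rewrite -[X in _ == X]addn0 -addn1 eqn_add2l.
have <- : #|strand_hi k |: (strand_lo k |: C)| = #|C|.+2.
  by rewrite !cardsU1 qC pC.
apply/subset_leq_card/subsetP => r; rewrite !inE.
by case/or3P => [/eqP->|/eqP->|/andP[]].
Qed.

(* Set partitions of the strands corresponding to the set partitions of the
   set of components of the closure of w. *)
Definition component_partition w P : Prop :=
  partition P [set: 'I_n] /\
  forall A, A \in P ->
    exists2 O : {set {set 'I_n}}, O \subset porbits (braid_perm w) & A = cover O.

Definition refines S P : Prop :=
  forall A, A \in S -> exists2 B, B \in P & A \subset B.

Definition coarsest_common_refinement w P Q S : Prop :=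
  [/\ component_partition w S, refines S P, refines S Q &
      forall S', component_partition w S' -> refines S' P -> refines S' Q ->
        refines S' S].

End BraidWords.

Section Varieties.
Variable K : fieldType.

(* The affine space with coordinates indexed by a finite type I is
   {ffun I -> K}; polynomial functions on it are given by {mpoly K[#|I|]}
   through the enumeration of I. *)
Definition pt_eval (I : finType) (p : {mpoly K[#|I|]}) (x : {ffun I -> K}) : K :=
  p.@[fun i => x (enum_val i)].

(* On a locally closed subset X of affine space: every point of X has a
   principal open neighbourhood {q != 0} in X on which h = p / q. *)
Definition regular_function (I : finType) (X : {ffun I -> K} -> Prop)
    (h : {ffun I -> K} -> K) : Prop :=
  forall x, X x -> exists p q : {mpoly K[#|I|]},
    pt_eval q x != 0 /\
    forall y, X y -> pt_eval q y != 0 -> h y = pt_eval p y / pt_eval q y.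

Definition morphism_of_varieties (I J : finType)
    (X : {ffun I -> K} -> Prop) (Y : {ffun J -> K} -> Prop)
    (f : {ffun I -> K} -> {ffun J -> K}) : Prop :=
  (forall x, X x -> Y (f x)) /\
  (forall j, regular_function X (fun x => f x j)).

Definition isomorphic_varieties (I J : finType)
    (X : {ffun I -> K} -> Prop) (Y : {ffun J -> K} -> Prop) : Prop :=
  exists (f : {ffun I -> K} -> {ffun J -> K}) (g : {ffun J -> K} -> {ffun I -> K}),
    [/\ morphism_of_varieties X Y f, morphism_of_varieties Y X g,
        (forall x, X x -> g (f x) = x) & (forall y, Y y -> f (g y) = y)].

Definition product_variety (J : finType) (I : J -> finType)
    (X : forall j, {ffun I j -> K} -> Prop) : {ffun {j : J & I j} -> K} -> Prop :=
  fun y => forall j, X j [ffun i => y (Tagged I i)].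

Definition leading_minor (n : nat) (M : 'M[K]_n) (i : nat) (hi : (i <= n)%N) : K :=
  \det (mxsub (widen_ord hi) (widen_ord hi) M).

Definition braid_mx1 (n : nat) (i : 'I_n.-1) (z : K) : 'M[K]_n :=
  \matrix_(a, b)
    if (a == lo i) && (b == lo i) then z
    else if (a == lo i) && (b == hi i) then -1
    else if (a == hi i) && (b == lo i) then 1
    else if (a == hi i) && (b == hi i) then 0
    else (a == b)%:R.

Definition braid_mx (n : nat) (w : seq 'I_n.-1) (z : {ffun 'I_(size w) -> K}) :
    'M[K]_n :=
  \big[mulmx/1%:M]_(k < size w) braid_mx1 (letter k) (z k).

Definition BS (n : nat) (w : seq 'I_n.-1) (z : {ffun 'I_(size w) -> K}) : Prop :=
  forall (i : nat) (hi : (i <= n)%N), (0 < i < n)%N ->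
    leading_minor (braid_mx z) hi != 0.

Definition subtorus (n : nat) (P : {set {set 'I_n}}) (t : {ffun 'I_n -> K}) : Prop :=
  (forall p, t p != 0) /\
  (forall A, A \in P -> {in A &, forall p q, t p = t q}).

Definition torus_act (n : nat) (w : seq 'I_n.-1) (t : {ffun 'I_n -> K})
    (z : {ffun 'I_(size w) -> K}) : {ffun 'I_(size w) -> K} :=
  [ffun k => t (strand_lo k) / t (strand_hi k) * z k].

Definition BS_fixed (n : nat) (w : seq 'I_n.-1) (P : {set {set 'I_n}})
    (z : {ffun 'I_(size w) -> K}) : Prop :=
  BS z /\ forall t, subtorus P t -> torus_act t z = z.

Definition BS_product (n : nat) (w : seq 'I_n.-1) (P : {set {set 'I_n}}) :
    {ffun {A : {A : {set 'I_n} | A \in P} & 'I_(size (subbraid (val A) w))} -> K}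
      -> Prop :=
  product_variety (fun A : {A : {set 'I_n} | A \in P} =>
                     @BS #|val A| (subbraid (val A) w)).

End Varieties.

Arguments BS_fixed K {n} w P z.
Arguments BS_product K {n} w P _.

(* Main.v *)
Require Import Defs.
From HB Require Import structures.
From mathcomp Require Import all_boot all_order all_algebra all_fingroup.
From mathcomp Require Import reals.
From mathcomp Require Import complex.
From mathcomp Require Import mpoly.
From mathcomp Require Import zify.

Set Implicit Arguments.
Unset Strict Implicit.
Unset Printing Implicit Defensive.

Import GRing.Theory.
Local Open Scope ring_scope.

(* A point is fixed by the subtorus iff z_k = 0 at every mixed crossing, i.e.
   every crossing of two strands of different blocks.  At such a point every
   mixed crossing contributes a signed transposition.  A diagonal matrix of
   signs can be moved past B_i(z) at the cost of a sign on z, so all the signs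
   can be collected at the right end, where they do not affect the vanishing of
   leading minors.  What remains is block diagonal with respect to the partition
   (each block is a union of orbits of the permutation), and its block on A is
   the braid matrix of the braid of the strands in A, with the coordinates of
   the point up to sign.  The leading minors of the whole matrix are nonzero iff
   those of the blocks are; this is checked on kernels, without factoring any
   determinant.  The isomorphism is therefore a signed coordinate projection. *)

(** * Level sets and elementary braid matrices *)

Section LevelSets.
Variables (K : fieldType) (n : nat).
Implicit Types (L : {set 'I_n}) (i : 'I_n.-1) (a b : 'I_n).

(** On [L] this is the 0-based position in increasing order. A natural [m] also serves as a cut: the
    first [m] levels contain [rank_in L m] levels of [L]. *)
Definition rank_in L (m : nat) : nat := #|[set b in L | (b < m)%N]|.

Lemma ltn_rank_in L a m : a \in L -> (rank_in L a < rank_in L m)%N = (a < m)%N.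
Proof.
move=> aL; case: (ltnP a m) => [am|ma].
  apply: proper_card; apply/properP; split.
    by apply/subsetP => b; rewrite !inE => /andP[-> /= /ltn_trans->].
  by exists a; rewrite !inE ?ltnn ?andbF ?aL ?am.
apply/negbTE; rewrite -leqNgt; apply/subset_leq_card/subsetP => b.
by rewrite !inE => /andP[-> /= /leq_trans->].
Qed.

Lemma rank_in_inj L : {in L &, injective (fun a => rank_in L a)}.
Proof.
move=> a b aL bL eab; apply/val_inj/eqP.
by rewrite eqn_leq leqNgt [X in _ && X]leqNgt -(ltn_rank_in b aL)
  -(ltn_rank_in a bL) eab ltnn.
Qed.

Lemma rank_in_lt L a : a \in L -> (rank_in L a < #|L|)%N.
Proof.
move=> aL; apply: proper_card; apply/properP; split.
  by apply/subsetP => b; rewrite inE => /andP[].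
by exists a; rewrite // inE ltnn andbF.
Qed.

Lemma rank_in_le L m : (rank_in L m <= #|L|)%N.
Proof. by apply/subset_leq_card/subsetP => b; rewrite inE => /andP[]. Qed.

Lemma rank_in_surj L r : (r < #|L|)%N -> exists2 a, a \in L & rank_in L a = r.
Proof.
(* The codomain has one value too many so that [inord] applies even to empty [L]; [ord_max] is never
   attained on [L], and counting gives surjectivity onto the rest. *)
move=> rL; pose f a : 'I_#|L|.+1 := inord (rank_in L a).
have fE a : f a = rank_in L a :> nat by rewrite inordK // ltnS rank_in_le.
have fi : {in L &, injective f}.
  by move=> a b aL bL /(congr1 val); rewrite /= !fE; apply: rank_in_inj.
pose S : {set 'I_#|L|.+1} := [set~ ord_max].
have : f @: L = S.
  apply/eqP; rewrite eqEcard card_in_imset // cardsC1 card_ord leqnn andbT.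
  apply/subsetP => _ /imsetP[a aL ->]; rewrite !inE -val_eqE /= fE.
  by rewrite ltn_eqF ?rank_in_lt.
have rE : (inord r : 'I_#|L|.+1) = r :> nat by rewrite inordK // ltnW.
move/setP/(_ (inord r)); rewrite !inE -val_eqE /= rE ltn_eqF //=.
by case/imsetP => a aL /(congr1 val); rewrite /= fE rE; exists a.
Qed.

Lemma lo_neq_hi i : lo i != hi i.
Proof. by rewrite -val_eqE /= neq_ltn ltnSn. Qed.

Lemma rank_in_hi L i : lo i \in L -> rank_in L (hi i) = (rank_in L (lo i)).+1.
Proof.
move=> lL; rewrite /rank_in -[RHS]add1n -[X in (X + _)%N](cards1 (lo i)).
rewrite -cardsUI [X in (_ + X)%N]eq_card0 ?addn0; last first.
  by move=> b; rewrite !inE; case: eqP => //= ->; rewrite ltnn andbF.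
apply: eq_card => b; rewrite !inE /= ltnS leq_eqVlt.
by case: (eqVneq b (lo i)) => [->|]; 
  rewrite -?val_eqE /= ?eqxx ?lL // => /negbTE->.
Qed.

(* When p = #|L|, the columns of [emb p L] are the basis vectors at the levels
   in L, in increasing order. *)
Definition emb p L : 'M[K]_(n, p) :=
  \matrix_(a, r) ((a \in L) && (rank_in L a == r))%:R.

Lemma emb_tr_emb L : (emb #|L| L)^T *m emb #|L| L = 1%:M.
Proof.
apply/matrixP => r r'; rewrite !mxE.
have [a aL ra] := rank_in_surj (ltn_ord r).
rewrite (bigD1 a) //= big1 => [|b ba]; rewrite !mxE.
  by rewrite aL ra eqxx mul1r addr0.
case: (boolP (b \in L)) => bL /=; last by rewrite mul0r.
case: eqP => [rb|]; last by rewrite mul0r.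
by case/eqP: ba; apply: (rank_in_inj bL aL); rewrite rb ra.
Qed.

Lemma emb_tr_emb0 p q L L' : [disjoint L & L'] -> (emb p L)^T *m emb q L' = 0.
Proof.
move=> dLL; apply/matrixP => r r'; rewrite !mxE big1 // => a _; rewrite !mxE.
case: (boolP (a \in L)) => aL; last by rewrite mul0r.
by rewrite (disjointFr dLL aL) mulr0.
Qed.

Lemma emb_mulE p L q (Y : 'M[K]_(p, q)) a c (r : 'I_p) :
  a \in L -> rank_in L a = r -> (emb p L *m Y) a c = Y r c.
Proof.
move=> aL ra; rewrite mxE (bigD1 r) //= big1 => [|r' rr']; rewrite mxE aL ra /=.
  by rewrite eqxx mul1r addr0.
by rewrite val_eqE eq_sym (negbTE rr') mul0r.
Qed.

Lemma emb_mul0 p L q (Y : 'M[K]_(p, q)) a c :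
  a \notin L -> (emb p L *m Y) a c = 0.
Proof.
by move=> aL; rewrite mxE big1 // => r _; rewrite mxE (negbTE aL) mul0r.
Qed.

(** Ranks increase along [L], so a cut at level [m] is a cut at rank [rank_in L m]. This links
    leading minors of the whole matrix to those of a block. *)
Lemma pid_emb (m : nat) L :
  (pid_mx m : 'M[K]_n) *m emb #|L| L = emb #|L| L *m pid_mx (rank_in L m).
Proof.
apply/matrixP => a r; case: (boolP (a \in L)) => aL; last first.
  rewrite emb_mul0 // mxE big1 // => b _; rewrite !mxE.
  by case: eqP => [/val_inj <-|]; rewrite ?(negbTE aL) ?mulr0 ?mul0r.
rewrite (emb_mulE _ _ (r := Ordinal (rank_in_lt aL))) // !mxE ltn_rank_in //.
rewrite (bigD1 a) //= big1 => [|b ba]; rewrite !mxE /=.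
  by rewrite eqxx aL addr0 /= -natrM mulnb andbC.
by rewrite (val_eqE a b) eq_sym (negbTE ba) mul0r.
Qed.

Lemma sum_emb (P : {set {set 'I_n}}) : partition P [set: 'I_n] ->
  \sum_(A in P) emb #|A| A *m (emb #|A| A)^T = 1%:M.
Proof.
case/and3P => /eqP cP tP _; apply/matrixP => a b; rewrite summxE !mxE.
have aP : a \in cover P by rewrite cP inE.
rewrite (bigD1 (pblock P a)) ?pblock_mem //= big1 ?addr0; last first.
  move=> A /andP[AP nA]; rewrite emb_mul0 //; apply: contra nA => aA.
  by rewrite eq_sym; apply/eqP/def_pblock.
have aA : a \in pblock P a by rewrite mem_pblock.
rewrite (emb_mulE _ _ (r := Ordinal (rank_in_lt aA))) // !mxE /=.
case: (eqVneq a b) => [<-|/eqP ab]; first by rewrite aA eqxx.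
by case: (boolP (b \in _)) => //= bA; case: eqP => // /(rank_in_inj bA aA)/esym.
Qed.

Lemma braid_mx1_mulE i z q (X : 'M[K]_(n, q)) a c :
  (braid_mx1 i z *m X) a c =
    if a == lo i then z * X (lo i) c - X (hi i) c
    else if a == hi i then X (lo i) c else X a c.
Proof.
have nlh := negbTE (lo_neq_hi i).
have nhl : (hi i == lo i) = false by rewrite eq_sym.
rewrite mxE; have [->|/negbTE al] := eqVneq a (lo i).
  rewrite (bigD1 (lo i)) //= (bigD1 (hi i)) ?nhl //= big1; last first.
    move=> b /andP[bl bh].
    by rewrite mxE !eqxx nlh (negbTE bl) (negbTE bh) /= eq_sym (negbTE bl) mul0r.
  by rewrite !mxE !eqxx nlh nhl /= mulN1r addr0.
have [->|/negbTE ah] := eqVneq a (hi i).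
  rewrite (bigD1 (lo i)) //= big1; last first.
    move=> b bl; rewrite mxE eqxx nhl (negbTE bl) /=.
    case: eqP => [_|]; first by rewrite mul0r.
    by rewrite eq_sym => /eqP/negbTE->; rewrite mul0r.
  by rewrite !mxE !eqxx nhl /= mul1r addr0.
rewrite (bigD1 a) //= big1; last first.
  by move=> b ba; rewrite mxE al ah /= eq_sym (negbTE ba) mul0r.
by rewrite mxE al ah /= eqxx mul1r addr0.
Qed.

Lemma braid_mx1_emb_out p L i z : lo i \notin L -> hi i \notin L ->
  braid_mx1 i z *m emb p L = emb p L.
Proof.
move=> lL hL; apply/matrixP => a r; rewrite braid_mx1_mulE.
case: eqP => [->|_]; first by rewrite !mxE (negbTE lL) (negbTE hL) mulr0 subr0.
by case: eqP => [->|//]; rewrite !mxE (negbTE lL) (negbTE hL).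
Qed.

(** An adjacent transposition reverses the order of one pair only, and that pair does not lie in
    [L]. *)
Lemma ltn_tperm_lo_hi L i a b : ~~ ((lo i \in L) && (hi i \in L)) ->
  a \in L -> b \in L ->
  (tperm (lo i) (hi i) b < tperm (lo i) (hi i) a)%N = (b < a)%N.
Proof.
move=> nL aL bL.
have nlh : ~ (a = lo i /\ b = hi i).
  by case=> ea eb; move: nL; rewrite -ea -eb aL bL.
have nhl : ~ (a = hi i /\ b = lo i).
  by case=> ea eb; move: nL; rewrite -ea -eb aL bL.
have vE (c d : 'I_n) : c = d <-> nat_of_ord c = d.
  by split=> [->|/val_inj].
move: nlh nhl; case: tpermP; rewrite ?vE /=; case: tpermP; rewrite ?vE /=; lia.
Qed.

Lemma tperm_emb p L i : ~~ ((lo i \in L) && (hi i \in L)) ->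
  tperm_mx (lo i) (hi i) *m emb p (tperm (lo i) (hi i) @: L) = emb p L.
Proof.
move=> nL; set s := tperm _ _; rewrite -row_permE; apply/matrixP => a r.
rewrite !mxE mem_imset; last exact: perm_inj.
case: (boolP (a \in L)) => //= aL; congr ((_ == _)%:R).
rewrite /rank_in -[RHS](card_imset _ (@perm_inj _ s)); apply: eq_card => c.
rewrite -[c](permKV s); set b := (s^-1)%g c.
rewrite inE !(mem_imset _ _ (@perm_inj _ s)) inE.
by case: (boolP (b \in L)) => //= bL; rewrite /s (ltn_tperm_lo_hi nL).
Qed.

(** The signs permuted by the crossing cancel on the entries -1 and 1; only the diagonal entry [z]
    keeps the product of the two signs. *)
Lemma braid_mx1_diag i z (d d' : 'rV[K]_n) : (forall a, d 0 a ^+ 2 = 1) ->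
  (forall a, d' 0 (tperm (lo i) (hi i) a) = d 0 a) ->
  braid_mx1 i z *m diag_mx d' =
    diag_mx d *m braid_mx1 i (d 0 (lo i) * d 0 (hi i) * z).
Proof.
move=> d2 dd'; have d'l : d' 0 (lo i) = d 0 (hi i) by rewrite -dd' tpermR.
have d'h : d' 0 (hi i) = d 0 (lo i) by rewrite -dd' tpermL.
have nlh := negbTE (lo_neq_hi i).
have nhl : (hi i == lo i) = false by rewrite eq_sym.
(* The factor [1%:M] lets [braid_mx1_mulE] compute the entries of the right-hand side too. *)
apply/matrixP => a c; rewrite braid_mx1_mulE -[braid_mx1 i _]mulmx1 mul_diag_mx.
rewrite mxE braid_mx1_mulE !mxE.
have [->|al] := eqVneq a (lo i).
  have [<-|_] := eqVneq (lo i) c.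
    rewrite eq_sym nlh mulr1n mulr0n !subr0 d'l mulr1 !mulrA -expr2 d2.
    by rewrite mul1r mulrC.
  have [_|_] := eqVneq (hi i) c; last by rewrite !mulr0n !mulr0 subr0 mulr0.
  by rewrite mulr0n mulr1n !mulr0 !sub0r d'h mulrN1.
have [->|ah] := eqVneq a (hi i).
  by case: eqVneq => _; rewrite ?d'l ?mulr1 ?mulr0.
have [_|_] := eqVneq a c; last by rewrite mulr0.
by rewrite mulr1n mulr1 -dd' tpermD // eq_sym.
Qed.

(* At a crossing with z = 0 the signs absorb the entry -1. *)
Lemma braid_mx1_0_diag i (d d' : 'rV[K]_n) : d' 0 (hi i) = - d 0 (lo i) ->
  (forall a, a != lo i -> d' 0 (tperm (lo i) (hi i) a) = d 0 a) ->
  braid_mx1 i 0 *m diag_mx d' = diag_mx d *m tperm_mx (lo i) (hi i).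
Proof.
move=> d'h dd'; have d'l : d' 0 (lo i) = d 0 (hi i).
  by rewrite -dd' ?tpermR // eq_sym lo_neq_hi.
apply/matrixP => a c; rewrite braid_mx1_mulE mul_diag_mx !mxE mul0r sub0r.
have [->|al] := eqVneq a (lo i).
  rewrite tpermL d'h; case: eqVneq => _;
  by rewrite ?mulr1n ?mulr1 ?opprK // mulr0 oppr0.
have [->|ah] := eqVneq a (hi i).
  by rewrite tpermR d'l; case: eqVneq => _; rewrite ?mulr1n ?mulr1 // mulr0.
rewrite -dd' // tpermD 1?eq_sym //.
by case: eqVneq => _; rewrite ?mulr1n ?mulr1 // mulr0.
Qed.

End LevelSets.

(** Consecutive levels in [L] have consecutive ranks. The size [p] is kept apart from [#|L|] because
    [L] will be a level set of a block [A], with [p] being [#|A|]. *)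
Lemma braid_mx1_emb_in (K : fieldType) (n p : nat) (L : {set 'I_n}) i
    (j : 'I_p.-1) (z : K) :
  #|L| = p -> lo i \in L -> hi i \in L -> rank_in L (lo i) = j ->
  braid_mx1 i z *m emb K p L = emb K p L *m braid_mx1 j z.
Proof.
move=> Lp lL hL rl.
have rh : rank_in L (hi i) = hi j by rewrite rank_in_hi // rl.
apply/matrixP => a r; rewrite braid_mx1_mulE.
case: (boolP (a \in L)) => aL; last first.
  rewrite emb_mul0 //; have [al|_] := eqVneq; first by rewrite al lL in aL.
  have [ah|_] := eqVneq; first by rewrite ah hL in aL.
  by rewrite mxE (negbTE aL).
have rp : (rank_in L a < p)%N by rewrite -Lp rank_in_lt.
rewrite (emb_mulE _ _ (r := Ordinal rp)) //.
have eqE b (c : 'I_p) :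
    b \in L -> rank_in L b = c -> (Ordinal rp == c) = (a == b).
  move=> bL rb; rewrite -val_eqE /= -rb.
  by apply/eqP/eqP => [/(rank_in_inj aL bL)|->].
rewrite -[braid_mx1 j z]mulmx1 braid_mx1_mulE.
by rewrite (eqE _ (lo j) lL rl) (eqE _ _ hL rh) !mxE aL lL hL rl rh.
Qed.

(** Used twice: with [E] the diagonal sign matrices, and with [E] the embeddings of the moving level
    sets of a block. *)
Lemma telescope_mulmx (K : fieldType) n p N (F : 'I_N -> 'M[K]_n)
    (G : 'I_N -> 'M[K]_p) (E : nat -> 'M[K]_(n, p)) :
  (forall k : 'I_N, F k *m E k.+1 = E k *m G k) ->
  \big[mulmx/1%:M]_(k < N) F k *m E N = E 0 *m \big[mulmx/1%:M]_(k < N) G k.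
Proof.
elim: N F G E => [|N IH] F G E FG; first by rewrite !big_ord0 mul1mx mulmx1.
rewrite !big_ord_recl -mulmxA.
rewrite (IH _ (fun k => G (lift ord0 k)) (fun k => E k.+1)).
  by rewrite mulmxA (FG ord0) mulmxA.
by move=> k; have := FG (lift ord0 k).
Qed.

(** * Leading minors and kernels *)

Section LeadingMinors.
Variable K : fieldType.

(** Injectivity of the leading block of size [m], expressed with truncated vectors of full length so
    that no matrix size depends on [m]. *)
Definition kernel_free n (m : nat) (M : 'M[K]_n) : Prop :=
  forall v : 'cV[K]_n, (pid_mx m : 'M_n) *m v = v ->
    (pid_mx m : 'M_n) *m (M *m v) = 0 -> v = 0.

Lemma det_neq0_kerP n (M : 'M[K]_n) :
  \det M != 0 <-> (forall v : 'cV[K]_n, M *m v = 0 -> v = 0).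
Proof.
rewrite -unitfE -unitmxE; split=> [uM v Mv|kM].
  by rewrite -(mulKmx uM v) Mv mulmx0.
(* [kermx] is the left kernel, hence the transposes. *)
rewrite -unitmx_tr -row_free_unit -kermx_eq0; apply/eqP/row_matrixP => r.
have : row r (kermx M^T) *m M^T = 0 by rewrite -row_mul mulmx_ker row0.
move/(congr1 trmx); rewrite trmx_mul trmxK trmx0 => /kM /(congr1 trmx).
by rewrite trmxK trmx0 row0.
Qed.

Lemma leading_minor_kernel_free n (M : 'M[K]_n) m (hm : (m <= n)%N) :
  leading_minor M hm != 0 <-> kernel_free m M.
Proof.
(* [W] includes the first [m] coordinates: the leading block is [W^T *m M *m W], and [W *m W^T] is
   the truncation. *)
pose W : 'M[K]_(n, m) := pid_mx m.
have WE : leading_minor M hm = \det (W^T *m M *m W).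
  congr (\det _); apply/matrixP => a b.
  rewrite !mxE (bigD1 (widen_ord hm b)) //=.
  rewrite big1 ?addr0 => [|c cb]; rewrite !mxE.
    rewrite (bigD1 (widen_ord hm a)) //= big1 ?addr0 => [|c ca].
      by rewrite !mxE /= !eqxx !ltn_ord /= mul1r mulr1.
    by move: ca; rewrite !mxE -val_eqE /= eq_sym => /negbTE->; rewrite mul0r.
  by move: cb; rewrite -val_eqE /= => /negbTE->; rewrite mulr0.
have WtE : W^T = pid_mx m by rewrite tr_pid_mx.
have WtW : W^T *m W = 1%:M by rewrite WtE pid_mx_id // pid_mx_1.
have WWt : W *m W^T = (pid_mx m : 'M_n).
  by rewrite WtE mul_pid_mx !minnn; congr pid_mx; apply/minn_idPr.
rewrite WE det_neq0_kerP; split=> [kM v vm Mv|kM v Mv].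
  have ve : v = W *m (W^T *m v) by rewrite mulmxA WWt vm.
  rewrite ve (kM (W^T *m v)) ?mulmx0 // -!mulmxA -ve.
  by rewrite -[W^T]mul1mx -WtW -!mulmxA (mulmxA W) WWt Mv mulmx0.
rewrite -[v]mul1mx -WtW -mulmxA (kM (W *m v)) ?mulmx0 //.
  by rewrite -WWt -mulmxA (mulmxA W^T) WtW mul1mx.
by rewrite -WWt -mulmxA (_ : W^T *m _ = 0) ?mulmx0 // -Mv !mulmxA.
Qed.

Lemma kernel_free0 n (M : 'M[K]_n) : kernel_free 0 M.
Proof. by move=> v <- _; rewrite pid_mx_0 mul0mx. Qed.

Lemma kernel_free_unit n (M : 'M[K]_n) : M \in unitmx -> kernel_free n M.
Proof.
move=> uM v _; rewrite pid_mx_1 mul1mx => Mv.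
by rewrite -(mulKmx uM v) Mv mulmx0.
Qed.

(** A diagonal sign matrix is an involution commuting with truncation, so it permutes the truncated
    vectors. *)
Lemma kernel_free_diag n (M : 'M[K]_n) m (d : 'rV[K]_n) :
  (forall a, d 0 a ^+ 2 = 1) ->
  kernel_free m M <-> kernel_free m (M *m diag_mx d).
Proof.
move=> d2; pose D := diag_mx d.
have DD : D *m D = 1%:M.
  apply/matrixP => a b; rewrite mul_diag_mx !mxE.
  by case: eqVneq => _; rewrite ?mulr1n -?expr2 ?d2 // mulr0.
have JD : (pid_mx m : 'M_n) *m D = D *m pid_mx m.
  rewrite mul_mx_diag mul_diag_mx; apply/matrixP => a b; rewrite !mxE.
  by case: eqP => [/val_inj->|_]; rewrite ?mul0r ?mulr0 // mulrC.
have sub M' : kernel_free m M' -> kernel_free m (M' *m D).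
  move=> kM v vm; rewrite -mulmxA => /kM Mv.
  by rewrite -[v]mul1mx -DD -mulmxA Mv ?mulmx0 // mulmxA JD -mulmxA vm.
by split=> [/sub//|/sub]; rewrite -mulmxA DD mulmx1.
Qed.

(** A kernel vector of a block embeds as one of [C]; conversely a kernel vector of [C] is the sum of
    its block components, each in the kernel of its block. *)
Lemma kernel_free_blocks n (P : {set {set 'I_n}}) (C : 'M[K]_n)
    (N : forall A : {set 'I_n}, 'M[K]_#|A|) m :
  partition P [set: 'I_n] ->
  (forall A, A \in P -> C *m emb K #|A| A = emb K #|A| A *m N A) ->
  kernel_free m C <-> (forall A, A \in P -> kernel_free (rank_in A m) (N A)).
Proof.
move=> pP CE; split=> [kC A AP u um Nu|kN v vm Cv].
  rewrite -[u]mul1mx -emb_tr_emb -mulmxA (kC (emb K #|A| A *m u)) ?mulmx0 //.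
    by rewrite mulmxA pid_emb -mulmxA um.
  by rewrite (mulmxA C) CE // -mulmxA mulmxA pid_emb -mulmxA Nu mulmx0.
have vE : v = \sum_(A in P) emb K #|A| A *m ((emb K #|A| A)^T *m v).
  rewrite -[LHS]mul1mx -(sum_emb K pP) mulmx_suml.
  by apply: eq_bigr => A _; rewrite mulmxA.
rewrite vE big1 // => A AP; set E := emb K #|A| A.
have Jt : pid_mx (rank_in A m) *m E^T = E^T *m (pid_mx m : 'M_n).
  by apply: trmx_inj; rewrite !trmx_mul !trmxK !tr_pid_mx pid_emb.
(* Insert the resolution of the identity [sum_emb] to the right of [C]; orthogonality of the blocks
   leaves only the term of [A]. *)
have tE : E^T *m C = N A *m E^T.
  rewrite -[C in LHS]mulmx1 -(sum_emb K pP) !mulmx_sumr (bigD1 A) //=.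
  rewrite big1 => [|B].
    by rewrite addr0 (mulmxA C) CE // !mulmxA emb_tr_emb mul1mx.
  case/andP=> BP BA; rewrite (mulmxA C) CE // !mulmxA emb_tr_emb0 ?mul0mx //.
  by case/and3P: pP => _ /trivIsetP tP _; apply: tP; rewrite // eq_sym.
rewrite (kN A AP (E^T *m v)) ?mulmx0 //; first by rewrite mulmxA Jt -mulmxA vm.
by rewrite !mulmxA -(mulmxA (pid_mx _)) -tE mulmxA Jt -!mulmxA Cv mulmx0.
Qed.

End LeadingMinors.

Lemma braid_mx1_unit (K : fieldType) n (i : 'I_n.-1) (z : K) :
  braid_mx1 i z \in unitmx.
Proof.
rewrite unitmxE unitfE; apply/det_neq0_kerP => v Bv; apply/matrixP => a c.
have E b := congr1 (fun M : 'cV[K]_n => M b c) Bv.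
have vl : v (lo i) c = 0.
  have := E (hi i); rewrite /= braid_mx1_mulE mxE eq_sym.
  by rewrite (negbTE (lo_neq_hi i)) eqxx.
have vh : v (hi i) c = 0.
  have := E (lo i); rewrite /= braid_mx1_mulE mxE eqxx vl mulr0 sub0r => /eqP.
  by rewrite oppr_eq0 => /eqP.
have := E a; rewrite /= braid_mx1_mulE mxE.
by case: eqVneq => [->|_]; last case: eqVneq => [->|].
Qed.

Lemma braid_mx_unit (K : fieldType) n (w : seq 'I_n.-1)
  (z : {ffun 'I_(size w) -> K}) : braid_mx z \in unitmx.
Proof.
apply: (big_ind (fun M : 'M[K]_n => M \in unitmx)); first exact: unitmx1.
  by move=> M M' uM uM'; rewrite unitmx_mul uM.
by move=> k _; apply: braid_mx1_unit.
Qed.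

(** The sizes 0 and [n] hold automatically, the latter by invertibility. Including them matters
    because a proper cut of the levels can have rank 0 or [#|A|] in a block [A]. *)
Lemma BS_kernel_free (K : fieldType) n (w : seq 'I_n.-1)
    (z : {ffun 'I_(size w) -> K}) :
  BS z <-> (forall m, (m <= n)%N -> kernel_free m (braid_mx z)).
Proof.
split=> [Bz m mn|kz m mn _]; last exact/leading_minor_kernel_free/kz.
case: (posnP m) => [->|m0]; first exact: kernel_free0.
move: (mn); rewrite leq_eqVlt => /orP[/eqP->|mn'].
  exact/kernel_free_unit/braid_mx_unit.
by apply/(leading_minor_kernel_free _ mn)/Bz; rewrite m0.
Qed.

Lemma big_cast_ord (T : Type) (op : T -> T -> T) x m n (e : m = n)
    (F : 'I_n -> T) :
  \big[op/x]_(i < n) F i = \big[op/x]_(i < m) F (cast_ord e i).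
Proof. by case: n / e in F *; apply: eq_bigr => i _; rewrite cast_ord_id. Qed.

HB.instance Definition _ (K : fieldType) n :=
  Monoid.isLaw.Build 'M[K]_n 1%:M (@mulmx K n n n)
    (@mulmxA K n n n n) (@mul1mx K n n) (@mulmx1 K n n).

(** * Decomposition of the braid matrix of a word *)

Section Word.
Variables (K : fieldType) (n : nat) (w : seq 'I_n.-1).
Implicit Types (k : 'I_(size w)) (A : {set 'I_n}) (P : {set {set 'I_n}}).

Notation lev k := (braid_perm (take k w)).

Lemma levelS k s :
  lev k.+1 s = tperm (lo (letter k)) (hi (letter k)) (lev k s).
Proof.
rewrite (take_nth (letter k)) // /braid_perm big_rcons /= permM.
by rewrite -(tnth_nth _ (in_tuple w)).
Qed.

Lemma level_lo k : lev k (strand_lo k) = lo (letter k).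
Proof. exact: permKV. Qed.

Lemma level_hi k : lev k (strand_hi k) = hi (letter k).
Proof. exact: permKV. Qed.

Lemma levelSV k a :
  ((lev k.+1)^-1)%g (tperm (lo (letter k)) (hi (letter k)) a) =
  ((lev k)^-1)%g a.
Proof. by apply: (@perm_inj _ (lev k.+1)); rewrite permKV levelS permKV. Qed.

Lemma level_imsetS k A :
  lev k.+1 @: A = tperm (lo (letter k)) (hi (letter k)) @: (lev k @: A).
Proof. by rewrite -imset_comp; apply: eq_imset => s /=; rewrite levelS. Qed.

Lemma lo_in_level k A : (lo (letter k) \in lev k @: A) = (strand_lo k \in A).
Proof. by rewrite -level_lo mem_imset //; apply: perm_inj. Qed.

Lemma hi_in_level k A : (hi (letter k) \in lev k @: A) = (strand_hi k \in A).
Proof. by rewrite -level_hi mem_imset //; apply: perm_inj. Qed.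

Definition mixed P k := pblock P (strand_lo k) != pblock P (strand_hi k).

(* The strand s changes sign at each mixed crossing where it is the lower
   strand, because of the entry -1 of the braid matrix. *)
Definition strand_sign P (m : nat) (s : 'I_n) : K :=
  \prod_(j < size w | [&& (j < m)%N, mixed P j & strand_lo j == s]) -1.

Lemma strand_sign_sqr P m s : strand_sign P m s ^+ 2 = 1.
Proof.
by rewrite /strand_sign -prodrXl big1 // => j _; rewrite sqrrN expr1n.
Qed.

Lemma strand_sign0 P s : strand_sign P 0 s = 1.
Proof. exact: big_pred0. Qed.

Lemma strand_signS P k s : strand_sign P k.+1 s =
  if mixed P k && (strand_lo k == s) then - strand_sign P k s
  else strand_sign P k s.
Proof.
rewrite /strand_sign; case: ifP => ks.
  rewrite (bigD1 k) ?ltnS ?leqnn //= mulN1r; congr (- _); apply: eq_bigl => j.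
  rewrite ltnS (ltn_neqAle j) -val_eqE /=.
  by case: (_ != _); rewrite ?andbT ?andbF.
apply: eq_bigl => j; rewrite ltnS leq_eqVlt val_eqE.
by have [->|] := eqVneq j k; rewrite //= ks andbF.
Qed.

Definition sign_row P m : 'rV[K]_n := \row_a strand_sign P m ((lev m)^-1 a)%g.

(** The factor that [braid_mx1_diag] puts on [z k] when the diagonal carries the strand signs just
    before crossing [k]. *)
Definition crossing_sign P k : K :=
  strand_sign P k (strand_lo k) * strand_sign P k (strand_hi k).

Lemma crossing_sign_sqr P k : crossing_sign P k ^+ 2 = 1.
Proof. by rewrite exprMn !strand_sign_sqr mulr1. Qed.

Variable z : {ffun 'I_(size w) -> K}.

(* The matrix of the crossing k conjugated by the signs of the strands. *)
Definition signed_crossing P k : 'M[K]_n :=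
  if mixed P k then tperm_mx (lo (letter k)) (hi (letter k))
  else braid_mx1 (letter k) (crossing_sign P k * z k).

Lemma braid_mx_sign P : (forall k, mixed P k -> z k = 0) ->
  braid_mx z *m diag_mx (sign_row P (size w)) =
    \big[mulmx/1%:M]_(k < size w) signed_crossing P k.
Proof.
move=> z0.
rewrite (telescope_mulmx (G := signed_crossing P)
  (E := fun m : nat => diag_mx (sign_row P m))).
  rewrite (_ : sign_row P 0 = const_mx 1) ?diag_const_mx ?mul1mx //.
  by apply/rowP => a; rewrite !mxE strand_sign0.
move=> k; rewrite /signed_crossing; case: ifP => mk.
  rewrite z0 //; apply: braid_mx1_0_diag.
    rewrite !mxE -{1}[hi _](tpermL (lo (letter k))) levelSV strand_signS mk.
    by rewrite eqxx.
  move=> a al; rewrite !mxE levelSV strand_signS mk.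
  case: eqP => // /(congr1 (lev k)); rewrite level_lo permKV => /esym/eqP.
  by rewrite (negbTE al).
rewrite (braid_mx1_diag _ (d := sign_row P k)) //.
- by rewrite !mxE.
- by move=> a; rewrite mxE strand_sign_sqr.
- by move=> a; rewrite !mxE levelSV strand_signS mk.
Qed.

(** The default [1%:M] is never reached when both strands lie in [A]: the lower one then has rank
    less than [#|A|.-1]. *)
Definition sub_crossing P A k : 'M[K]_#|A| :=
  if insub (rank_in (lev k @: A) (letter k)) is Some j
  then braid_mx1 j (crossing_sign P k * z k) else 1%:M.

(** At a mixed crossing at most one strand lies in [A], so ranks are kept. At any other crossing
    both or neither do, so the level set of [A] is kept. *)
Lemma signed_crossing_emb P A k : partition P [set: 'I_n] -> A \in P ->
  signed_crossing P k *m emb K #|A| (lev k.+1 @: A) =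
  emb K #|A| (lev k @: A) *m
    (if (strand_lo k \in A) && (strand_hi k \in A)
     then sub_crossing P A k else 1%:M).
Proof.
case/and3P => /eqP cP tP _ AP.
have inA s : (s \in A) = (pblock P s == A).
  apply/idP/eqP => [sA|<-]; first exact: def_pblock.
  by rewrite mem_pblock cP.
rewrite /signed_crossing level_imsetS.
case: ifP => [mk|/negbT/negPn mk].
  have nA : (strand_lo k \in A) && (strand_hi k \in A) = false.
    apply: contraNF mk; rewrite !inA => /andP[/eqP-> /eqP->] //.
  by rewrite nA mulmx1 tperm_emb // lo_in_level hi_in_level nA.
have lhA : (strand_lo k \in A) = (strand_hi k \in A).
  by rewrite !inA (eqP mk).
have -> : tperm (lo (letter k)) (hi (letter k)) @: (lev k @: A) = lev k @: A.
  apply/setP => a; rewrite -[a](tpermK (lo (letter k)) (hi (letter k))).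
  rewrite mem_imset; last exact: perm_inj.
  rewrite tpermK.
  by case: tpermP => [->|->|//]; rewrite lo_in_level hi_in_level lhA.
rewrite lhA andbb; case: ifP => hA; last first.
  by rewrite mulmx1 braid_mx1_emb_out // ?lo_in_level ?hi_in_level ?lhA hA.
have cA : #|lev k @: A| = #|A| by rewrite card_imset //; apply: perm_inj.
have ll : lo (letter k) \in lev k @: A by rewrite lo_in_level lhA.
have hl : hi (letter k) \in lev k @: A by rewrite hi_in_level.
rewrite /sub_crossing; case: insubP => [j _ jE|].
  exact: braid_mx1_emb_in.
rewrite ltn_predRL -cA => /negP[]; rewrite -(rank_in_hi ll).
exact: rank_in_lt.
Qed.

(** * Crossings and coordinates of the braid of one block *)

Definition crossings A : seq 'I_(size w) :=
  [seq k <- enum 'I_(size w) | (strand_lo k \in A) && (strand_hi k \in A)].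

Lemma size_subbraid A : size (subbraid A w) = size (crossings A).
Proof. by rewrite -(size_map val) val_subbraid size_map. Qed.

Definition crossing_of A (j : 'I_(size (subbraid A w))) : 'I_(size w) :=
  tnth (in_tuple (crossings A)) (cast_ord (size_subbraid A) j).

Lemma val_letter_subbraid A (j : 'I_(size (subbraid A w))) :
  val (letter j) = rank_in (lev (crossing_of j) @: A) (letter (crossing_of j)).
Proof.
rewrite /letter (tnth_nth (letter j)) -(nth_map _ 0%N) // val_subbraid.
rewrite (nth_map (crossing_of j)) -?size_subbraid //.
have -> : nth (crossing_of j) (crossings A) j = crossing_of j.
  by rewrite {2}/crossing_of (tnth_nth (crossing_of j)).
(* [sub_letters] counts strands while [rank_in] counts levels; the permutation [level] matches the
   two sets. *)
rewrite /rank_in -[LHS](card_imset _ (@perm_inj _ (level (crossing_of j)))).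
apply: eq_card => a; rewrite -[a](permKV (level (crossing_of j))).
by rewrite !(inE, mem_imset _ _ (@perm_inj _ _)).
Qed.

Definition sub_point P A : {ffun 'I_(size (subbraid A w)) -> K} :=
  [ffun j => crossing_sign P (crossing_of j) * z (crossing_of j)].

Lemma braid_mx_sub_point P A :
  \big[mulmx/1%:M]_(k < size w)
    (if (strand_lo k \in A) && (strand_hi k \in A)
     then sub_crossing P A k else 1%:M)
  = braid_mx (sub_point P A).
Proof.
have cE : [seq k <- index_enum 'I_(size w) |
      (strand_lo k \in A) && (strand_hi k \in A)] = crossings A.
  by rewrite /crossings enumT [index_enum _]unlock.
rewrite -big_mkcond -big_filter cE big_tnth.
rewrite (big_cast_ord _ _ (size_subbraid A)); apply: eq_bigr => j _.
rewrite -/(crossing_of j) /sub_crossing -val_letter_subbraid valK ffunE.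
by [].
Qed.

(** Stability of [A] under [braid_perm w] makes the embeddings at both ends of the word coincide, so
    the signed braid matrix is block diagonal. *)
Lemma sub_point_BS P : partition P [set: 'I_n] ->
  (forall A, A \in P -> braid_perm w @: A = A) ->
  (forall k, mixed P k -> z k = 0) ->
  BS z <-> (forall A, A \in P -> BS (sub_point P A)).
Proof.
move=> pP sP z0.
have CE A : A \in P ->
    braid_mx z *m diag_mx (sign_row P (size w)) *m emb K #|A| A =
     emb K #|A| A *m braid_mx (sub_point P A).
  move=> AP; rewrite braid_mx_sign //.
  have E0 : lev 0 @: A = A.
    rewrite take0 /braid_perm big_nil -[RHS]imset_id.
    by apply: eq_imset => s; rewrite perm1.
  have EN : lev (size w) @: A = A by rewrite take_size sP.
  have := telescope_mulmx (E := fun m : nat => emb K #|A| (lev m @: A))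
    (fun k => signed_crossing_emb k pP AP).
  by rewrite EN E0 braid_mx_sub_point.
have d2 a : sign_row P (size w) 0 a ^+ 2 = 1 by rewrite mxE strand_sign_sqr.
have kfE m := iff_trans (kernel_free_diag (braid_mx z) m d2)
  (kernel_free_blocks m pP CE).
rewrite BS_kernel_free; split=> [kB A AP|BA m mn].
  apply/BS_kernel_free => m; rewrite leq_eqVlt => /orP[/eqP->|].
    exact/kernel_free_unit/braid_mx_unit.
  (* Each proper minor size of a block is the rank of some level [a] in [A]; cutting the whole
     matrix at [a] tests that minor. *)
  by case/rank_in_surj => a aA <-; apply: (iffLR (kfE _)) => //; apply/kB/ltnW.
apply/kfE => A AP; apply: (iffLR (BS_kernel_free _)); first exact: BA.
exact: rank_in_le.
Qed.

End Word.

(** * Set partitions of the strands *)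

Section Partitions.
Variables (n : nat) (w : seq 'I_n.-1).
Implicit Types (A B : {set 'I_n}) (P Q S : {set {set 'I_n}}).

Lemma component_partitionP P : component_partition w P <->
  partition P [set: 'I_n] /\ (forall A, A \in P -> braid_perm w @: A = A).
Proof.
set s := braid_perm w; split=> -[pP cP]; split=> // A AP.
  (* A permutation preserves cardinality, so one inclusion suffices. *)
  apply/eqP; rewrite eqEcard card_imset ?leqnn ?andbT; last exact: perm_inj.
  have [O /subsetP sO ->] := cP A AP.
  apply/subsetP => _ /imsetP[a /bigcupP[X XO aX] ->].
  apply/bigcupP; exists X => //.
  have /imsetP[x _ EX] := sO _ XO; rewrite EX in aX *.
  by rewrite -{1}(expg1 s) porbit_sym porbit_perm porbit_sym.
have sA a : a \in A -> porbit s a \subset A.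
  move=> aA; apply/subsetP => _ /porbitP[i ->]; elim: i => [|i IH].
    by rewrite expg0 perm1.
  by rewrite expgSr permM -(cP _ AP) imset_f.
exists [set porbit s a | a in A].
  by apply/subsetP => _ /imsetP[a _ ->]; apply: imset_f.
apply/setP => a; apply/idP/bigcupP => [aA|[_ /imsetP[b bA ->]]].
  by exists (porbit s a); rewrite ?imset_f ?porbit_id.
exact/subsetP/sA.
Qed.

(** The nonempty intersections of a block of [P] with a block of [Q], obtained as fibres so that the
    empty set never arises. *)
Definition common_refinement P Q : {set {set 'I_n}} :=
  preim_partition (fun a => (pblock P a, pblock Q a)) [set: 'I_n].

Lemma common_refinement_partition P Q :
  partition (common_refinement P Q) [set: 'I_n].
Proof. exact: preim_partitionP. Qed.

Lemma mem_pblock_common_refinement P Q a b :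
  (b \in pblock (common_refinement P Q) a) =
  (pblock P a == pblock P b) && (pblock Q a == pblock Q b).
Proof. by rewrite pblock_equivalence_partition ?inE //; split=> // /eqP->. Qed.

Lemma pblock_common_refinement P Q a :
  partition P [set: 'I_n] -> partition Q [set: 'I_n] ->
  pblock (common_refinement P Q) a = pblock P a :&: pblock Q a.
Proof.
case/and3P=> /eqP cP tP _ /and3P[/eqP cQ tQ _]; apply/setP => b.
by rewrite mem_pblock_common_refinement !eq_pblock ?cP ?cQ // inE.
Qed.

Lemma eq_pblock_common_refinement P Q a b :
  (pblock (common_refinement P Q) a == pblock (common_refinement P Q) b) =
  (pblock P a == pblock P b) && (pblock Q a == pblock Q b).
Proof.
case/and3P: (common_refinement_partition P Q) => /eqP cS tS _.
by rewrite eq_pblock ?cS // mem_pblock_common_refinement.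
Qed.

Lemma partition_blockP P A : partition P [set: 'I_n] -> A \in P ->
  exists2 a, a \in A & A = pblock P a.
Proof.
case/and3P=> _ tP P0 AP.
have [A0|[a aA]] := set_0Vmem A; first by rewrite -A0 AP in P0.
by exists a => //; rewrite (def_pblock tP AP aA).
Qed.

Lemma common_refinementP P Q :
  component_partition w P -> component_partition w Q ->
  coarsest_common_refinement w P Q (common_refinement P Q).
Proof.
move=> /component_partitionP[pP sP] /component_partitionP[pQ sQ].
have pS := common_refinement_partition P Q.
have bP a : pblock P a \in P.
  by case/and3P: pP => /eqP cP _ _; rewrite pblock_mem ?cP.
have bQ a : pblock Q a \in Q.
  by case/and3P: pQ => /eqP cQ _ _; rewrite pblock_mem ?cQ.
have bS a : pblock (common_refinement P Q) a \in common_refinement P Q.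
  by case/and3P: pS => /eqP cS _ _; rewrite pblock_mem ?cS.
have SE A : A \in common_refinement P Q ->
    exists a, A = pblock P a :&: pblock Q a.
  case/(partition_blockP pS) => a _ ->; exists a.
  exact: pblock_common_refinement.
split.
- apply/component_partitionP; split=> // _ /SE[a ->].
  rewrite imsetI; first by rewrite (sP _ (bP a)) (sQ _ (bQ a)).
  by move=> ? ? _ _; apply: perm_inj.
- by move=> _ /SE[a ->]; exists (pblock P a); [exact: bP | exact: subsetIl].
- by move=> _ /SE[a ->]; exists (pblock Q a); [exact: bQ | exact: subsetIr].
move=> S' /component_partitionP[pS' _] rP rQ A AS'.
have [a aA _] := partition_blockP pS' AS'.
exists (pblock (common_refinement P Q) a); first exact: bS.
rewrite pblock_common_refinement // subsetI.
have [B BP AB] := rP A AS'; have [C CQ AC] := rQ A AS'.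
case/and3P: pP => _ tP _; case/and3P: pQ => _ tQ _.
rewrite (def_pblock tP BP (subsetP AB a aA)) AB.
by rewrite (def_pblock tQ CQ (subsetP AC a aA)).
Qed.

End Partitions.

(** * Fixed points *)

Section Varieties.
Variable K : fieldType.

(** Covers all coordinates of both maps of the isomorphism, except the identically zero ones at
    mixed crossings. *)
Lemma regular_scaled_coord (I : finType) (X : {ffun I -> K} -> Prop) (c : K) i
    (h : {ffun I -> K} -> K) :
  (forall x, h x = c * x i) -> regular_function X h.
Proof.
move=> hE x _; exists (c *: 'X_(enum_rank i)), 1; rewrite /pt_eval meval1.
split=> [|y _ _]; first exact: oner_neq0.
by rewrite mevalZ mevalXU enum_rankK meval1 divr1 hE.
Qed.

Lemma BS_fixedP n (w : seq 'I_n.-1) (P : {set {set 'I_n}}) z :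
  (2 != 0 :> K) -> partition P [set: 'I_n] ->
  BS_fixed K w P z <-> BS z /\ (forall k, mixed P k -> z k = 0).
Proof.
move=> K2 /and3P[/eqP cP tP _]; split=> -[Bz fz]; split=> //.
  move=> k mk.
  (* This torus element separates the blocks of the two strands: it halves [z k], so being fixed
     forces [z k = 0]. *)
  pose t : {ffun 'I_n -> K} :=
    [ffun s => if pblock P s == pblock P (strand_lo k) then 1 else 2].
  have tP' : subtorus P t.
    split=> [s|A AP p q pA qA]; rewrite !ffunE.
      by case: ifP => _ //; apply: oner_neq0.
    by rewrite (def_pblock tP AP pA) (def_pblock tP AP qA).
  have /ffunP/(_ k) := fz t tP'; rewrite !ffunE eqxx eq_sym (negbTE mk) div1r.
  move/(congr1 (fun x => 2 * x)); rewrite mulVKf // mulr_natl mulr2n => /eqP.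
  by rewrite -subr_eq0 opprD addNKr oppr_eq0 => /eqP.
move=> t [t0 tA]; apply/ffunP => k; rewrite ffunE.
case: (boolP (mixed P k)) => [/fz->|/negPn/eqP mk]; first by rewrite mulr0.
rewrite (tA (pblock P (strand_lo k)) _ _ (strand_hi k)) ?divff ?mul1r //.
- by rewrite pblock_mem ?cP.
- by rewrite mem_pblock cP.
- by rewrite mk mem_pblock cP.
Qed.

(** * The signed coordinate projection and its inverse *)

Section Iso.
Variables (n : nat) (w : seq 'I_n.-1) (P : {set {set 'I_n}}).
Hypothesis wP : component_partition w P.

Let T := {A : {A : {set 'I_n} | A \in P} & 'I_(size (subbraid (val A) w))}.

Definition crossing_in (u : T) : 'I_(size w) := crossing_of (tagged u).

Lemma crossing_ofP (A : {set 'I_n}) (j : 'I_(size (subbraid A w))) :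
  (strand_lo (crossing_of j) \in A) && (strand_hi (crossing_of j) \in A).
Proof.
by have := mem_tnth (cast_ord (size_subbraid w A) j) (in_tuple (crossings w A));
  rewrite mem_filter => /andP[].
Qed.

(** The lower strand of a crossing determines the block, and the list of crossings of a block has no
    repetition. *)
Lemma crossing_in_inj : injective crossing_in.
Proof.
case/component_partitionP: wP => /and3P[_ tP _] _.
move=> [A j] [B k]; rewrite /crossing_in /= => jk.
have AB : A = B.
  apply: val_inj; case/andP: (crossing_ofP j) => jA _.
  case/andP: (crossing_ofP k); rewrite -jk => kB _.
  by rewrite -(def_pblock tP (valP A) jA) (def_pblock tP (valP B) kB).
case: B / AB k jk => k /eqP.
have uc : uniq (crossings w (val A)) by apply/filter_uniq/enum_uniq.
rewrite /crossing_of !(tnth_nth (crossing_of j)) nth_uniq //.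
by move=> /eqP/val_inj/cast_ord_inj->.
Qed.

Lemma mixed_crossing_in u : ~~ mixed P (crossing_in u).
Proof.
case/component_partitionP: wP => /and3P[_ tP _] _.
case: u => A j; case/andP: (crossing_ofP j) => lA hA.
by rewrite /mixed !(def_pblock tP (valP A)) // eqxx.
Qed.

Lemma crossing_in_surj k : ~~ mixed P k -> exists u, crossing_in u = k.
Proof.
case/component_partitionP: wP => /and3P[/eqP cP tP _] _ /negPn/eqP mk.
have AP : pblock P (strand_lo k) \in P by rewrite pblock_mem ?cP.
pose A : {A : {set 'I_n} | A \in P} := Sub (pblock P (strand_lo k)) AP.
have kA : k \in crossings w (val A).
  by rewrite mem_filter mem_enum /= {2}mk !mem_pblock cP !inE.
have kj : (index k (crossings w (val A)) < size (subbraid (val A) w))%N.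
  by rewrite size_subbraid index_mem.
exists (existT (fun A => 'I_(size (subbraid (val A) w))) A (Ordinal kj)).
rewrite /crossing_in /crossing_of /=.
by rewrite (tnth_nth k) /= nth_index.
Qed.

Definition restrict_point (z : {ffun 'I_(size w) -> K}) : {ffun T -> K} :=
  [ffun u => crossing_sign K P (crossing_in u) * z (crossing_in u)].

(** The index [u] is unique when it exists, and the sign is that of [restrict_point] since signs are
    their own inverses. The default 0 occurs exactly at mixed crossings. *)
Definition extend_point (y : {ffun T -> K}) : {ffun 'I_(size w) -> K} :=
  [ffun k => if [pick u | crossing_in u == k] is Some u
             then crossing_sign K P k * y u else 0].

Lemma restrict_pointP (z : {ffun 'I_(size w) -> K}) :
  (forall k, mixed P k -> z k = 0) ->
  BS z <-> BS_product K w P (restrict_point z).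
Proof.
move=> z0; case/component_partitionP: wP => pP sP.
rewrite (sub_point_BS pP sP z0).
split=> [Bz A|Bz A AP].
  rewrite (_ : [ffun _ => _] = sub_point z P (val A)); first exact/Bz/valP.
  by apply/ffunP => i; rewrite !ffunE.
rewrite (_ : sub_point z P A =
             sub_point z P (val (Sub A AP : {A | A \in P}))) //.
have := Bz (Sub A AP); congr (BS _).
by apply/ffunP => i; rewrite !ffunE.
Qed.

Lemma restrict_pointK (z : {ffun 'I_(size w) -> K}) :
  (forall k, mixed P k -> z k = 0) ->
  extend_point (restrict_point z) = z.
Proof.
move=> z0; apply/ffunP => k; rewrite ffunE; case: pickP => [u /eqP uk|nk].
  by rewrite ffunE uk mulrA -expr2 crossing_sign_sqr mul1r.
rewrite z0 //; apply: contraT => /crossing_in_surj[u uk].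
by have := nk u; rewrite uk eqxx.
Qed.

Lemma extend_pointK y : restrict_point (extend_point y) = y.
Proof.
apply/ffunP => u; rewrite !ffunE.
case: pickP => [v /eqP/crossing_in_inj->|/(_ u)].
  by rewrite mulrA -expr2 crossing_sign_sqr mul1r.
by rewrite eqxx.
Qed.

Lemma extend_point_mixed y k : mixed P k -> extend_point y k = 0.
Proof.
move=> mk; rewrite ffunE; case: pickP => // u /eqP uk.
by move: mk; rewrite -uk (negbTE (mixed_crossing_in u)).
Qed.

(** [X] is kept abstract to serve both for one fixed locus and for the intersection of two. *)
Lemma isomorphic_BS_product (X : {ffun 'I_(size w) -> K} -> Prop) :
  (forall z, X z <-> BS z /\ (forall k, mixed P k -> z k = 0)) ->
  isomorphic_varieties X (BS_product K w P).
Proof.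
move=> XE; exists restrict_point, extend_point; split.
- split=> [z /XE[Bz z0]|u]; first exact/restrict_pointP.
  by apply: regular_scaled_coord => z; rewrite ffunE.
- split=> [y By|k].
    apply/XE; have y0 := extend_point_mixed y; split=> //.
    by apply/(restrict_pointP y0); rewrite extend_pointK.
  have [u /eqP uk|nk] := pickP (fun u => crossing_in u == k).
    apply: (@regular_scaled_coord _ _ (crossing_sign K P k) u) => y.
    rewrite ffunE.
    case: pickP => [v /eqP vk|/(_ u)]; last by rewrite uk eqxx.
    by rewrite (@crossing_in_inj v u) // vk.
  move=> y _; exists 0, 1; rewrite /pt_eval meval1.
  split=> [|x _ _]; first exact: oner_neq0.
  by rewrite meval0 mul0r ffunE; case: pickP => // v; rewrite nk.
- by move=> z /XE[_ z0]; apply: restrict_pointK.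
- by move=> y _; apply: extend_pointK.
Qed.

End Iso.
End Varieties.

Theorem corollary6p7 (R : realType) (n : nat) (hn : (0 < n)%N) (w : seq 'I_n.-1) :
  (forall P : {set {set 'I_n}}, component_partition w P ->
     isomorphic_varieties (BS_fixed (complex R) w P) (BS_product (complex R) w P))
  /\
  (forall P Q : {set {set 'I_n}},
     component_partition w P -> component_partition w Q ->
     exists2 S : {set {set 'I_n}}, coarsest_common_refinement w P Q S &
       isomorphic_varieties
         (fun z => BS_fixed (complex R) w P z /\ BS_fixed (complex R) w Q z)
         (BS_product (complex R) w S)).
Proof.
have C2 : 2 != 0 :> complex R by rewrite Num.Theory.pnatr_eq0.
split=> [P wP|P Q wP wQ].
  apply: isomorphic_BS_product => // z; apply: BS_fixedP => //.
  by case/component_partitionP: wP.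
have cS := common_refinementP wP wQ; exists (common_refinement P Q) => //.
apply: isomorphic_BS_product => [|z]; first by case: cS.
case/component_partitionP: wP => pP _; case/component_partitionP: wQ => pQ _.
rewrite (BS_fixedP z C2 pP) (BS_fixedP z C2 pQ).
(* Hence the two vanishing conditions amount to the single one for the common refinement. *)
have mE k : mixed (common_refinement P Q) k = mixed P k || mixed Q k.
  by rewrite /mixed eq_pblock_common_refinement negb_and.
split=> [[[Bz zP] [_ zQ]]|[Bz zS]].
  by split=> // k; rewrite mE => /orP[/zP|/zQ].
by split; split=> // k mk; apply: zS; rewrite mE mk ?orbT.
Qed.
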